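(* For every finite distributive lattice $L$, $\operatorname{RCSub}(L)$ is a ranked lattice.
   Context: Sublattices are nonempty by convention. For elements $u,x,v$ of a lattice $L$, let $\mathrm{rc}_L(u,x,v):=\{y\in L : x\wedge y=u \text{ and } x\vee y=v\}$. A sublattice $S$ of $L$ is RC-closed (closed with respect to taking relative complements) if $\mathrm{rc}_L(u,x,v)\subseteq S$ for all $u,x,v\in S$. $\operatorname{RCSub}(L)$ denotes the set consisting of the empty set and all RC-closed sublattices of $L$, ordered by set inclusion $\subseteq$; it is an algebraic lattice. A finite chain $C$ has length $|C|-1$. A ranked lattice is a lattice in which any two maximal chains of every principal ideal are of the same finite length. *)

(* Defs.v *)
From HB Require Import structures.
From mathcomp Require Import all_boot all_order.

Set Implicit Arguments.
Unset Strict Implicit.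
Unset Printing Implicit Defensive.

Import Order.Theory Order.ClosedPredicates.
Local Open Scope order_scope.

Section RCSub.
Context {d : Order.disp_t} {L : finLatticeType d}.
Implicit Types (u x v : L) (S : {set L}).

Definition rc u x v : {set L} :=
  [set y | (x `&` y == u) && (x `|` y == v)].

(* Sublattices are nonempty and need not contain the bounds of L. *)
Definition sublattice S : bool :=
  (S != set0) &&
  [forall x in S, forall y in S, (x `&` y \in S) && (x `|` y \in S)].

Definition rc_closed S : bool :=
  [forall u in S, forall x in S, forall v in S, rc u x v \subset S].

(* The empty set is not a sublattice; it is adjoined separately. *)
Definition in_RCSub S : bool := (S == set0) || (sublattice S && rc_closed S).

Lemma sublatticeP S :
  reflect [/\ S != set0, meet_closed S & join_closed S]
          (sublattice S).
Proof.
apply: (iffP andP) => [[S0 /forall_inP H]|[S0 HI HU]]; split=> //.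
- by move=> x y xS yS; have /forall_inP/(_ y yS)/andP[] := H x xS.
- by move=> x y xS yS; have /forall_inP/(_ y yS)/andP[] := H x xS.
by apply/forall_inP => x xS; apply/forall_inP => y yS; rewrite HI ?HU.
Qed.

Lemma rc_closedP S :
  reflect (forall u x v, u \in S -> x \in S -> v \in S -> rc u x v \subset S)
          (rc_closed S).
Proof.
apply: (iffP forall_inP) => [H u x v uS xS vS|H u uS].
  by have /forall_inP/(_ x xS)/forall_inP/(_ v vS) := H u uS.
by apply/forall_inP => x xS; apply/forall_inP => v vS; apply: H.
Qed.

Lemma in_RCSubP S :
  reflect [/\ meet_closed S, join_closed S &
     forall u x v, u \in S -> x \in S -> v \in S -> rc u x v \subset S]
    (in_RCSub S).
Proof.
apply: (iffP orP) => [[/eqP->|/andP[/sublatticeP[_ SI SU] /rc_closedP SR]]|].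
- by split=> [x|x|u]; rewrite ?inE // => x v; rewrite inE.
- by split.
case=> SI SU SR; have [|S0] := boolP (S == set0); [by left | right].
by apply/andP; split; [apply/sublatticeP | apply/rc_closedP].
Qed.

Lemma in_RCSubI A B : in_RCSub A -> in_RCSub B -> in_RCSub (A :&: B).
Proof.
move=> /in_RCSubP[AI AU AR] /in_RCSubP[BI BU BR]; apply/in_RCSubP.
split=> [x y|x y|u x v]; rewrite !inE => /andP[xA xB] /andP[yA yB].
- by rewrite AI ?BI.
- by rewrite AU ?BU.
by move=> /andP[vA vB]; rewrite subsetI AR ?BR.
Qed.

Lemma in_RCSubT : in_RCSub [set: L].
Proof.
apply/in_RCSubP; split=> [x y _ _|x y _ _|u x v _ _ _]; last exact: subsetT.
  exact: in_setT.
exact: in_setT.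
Qed.

(* The least member of RCSub L that includes S. *)
Definition RCgen S : {set L} :=
  \bigcap_(A : {set L} | in_RCSub A && (S \subset A)) A.

Lemma in_RCSub_gen S : in_RCSub (RCgen S).
Proof.
rewrite /RCgen; apply: (big_ind (fun A => in_RCSub A)).
- exact: in_RCSubT.
- by move=> A B; apply: in_RCSubI.
by move=> A /andP[].
Qed.

Lemma RCgen_sub S A : in_RCSub A -> (RCgen S \subset A) = (S \subset A).
Proof.
move=> RA; apply/idP/idP => [|SA].
  by apply: subset_trans; apply/bigcapsP => B /andP[].
by apply: (bigcap_min A); rewrite ?RA ?SA.
Qed.

End RCSub.

Record RCSub d (L : finLatticeType d) := MkRCSub {
  RCSub_set :> {set L};
  RCSub_axiom : in_RCSub RCSub_set
}.

HB.instance Definition _ d (L : finLatticeType d) :=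
  [isSub for @RCSub_set d L].
HB.instance Definition _ d (L : finLatticeType d) :=
  [Finite of RCSub L by <:].

Fact RCSub_display : Order.disp_t. Proof. exact: Order.Disp tt tt. Qed.

Section RCSubOrder.
Context {d : Order.disp_t} {L : finLatticeType d}.
Implicit Types X Y Z : RCSub L.

Definition RCSub_le X Y : bool := RCSub_set X \subset RCSub_set Y.

Fact RCSub_le_refl : reflexive RCSub_le.
Proof. by move=> X; apply: subxx. Qed.

Fact RCSub_le_anti : antisymmetric RCSub_le.
Proof. by move=> X Y XY; apply/val_inj/eqP; rewrite eqEsubset. Qed.

Fact RCSub_le_trans : transitive RCSub_le.
Proof. by move=> Y X Z; apply: subset_trans. Qed.

HB.instance Definition _ := Order.Le_isPOrder.Build RCSub_display (RCSub L)
  RCSub_le_refl RCSub_le_anti RCSub_le_trans.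

Lemma leERCSub X Y : (X <= Y) = (RCSub_set X \subset RCSub_set Y).
Proof. by []. Qed.

Definition RCSub_meet X Y : RCSub L :=
  MkRCSub (in_RCSubI (RCSub_axiom X) (RCSub_axiom Y)).

Definition RCSub_join X Y : RCSub L :=
  MkRCSub (in_RCSub_gen (RCSub_set X :|: RCSub_set Y)).

Fact RCSub_lexI X Y Z : (X <= RCSub_meet Y Z) = (X <= Y) && (X <= Z).
Proof. by rewrite !leERCSub subsetI. Qed.

Fact RCSub_leUx X Y Z : (RCSub_join X Y <= Z) = (X <= Z) && (Y <= Z).
Proof. by rewrite !leERCSub RCgen_sub ?subUset ?(RCSub_axiom Z). Qed.

HB.instance Definition _ := Order.POrder_isMeetSemilattice.Build
  RCSub_display (RCSub L) RCSub_lexI.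
HB.instance Definition _ := Order.POrder_isJoinSemilattice.Build
  RCSub_display (RCSub L) RCSub_leUx.

End RCSubOrder.

Section Ranked.
Context {d : Order.disp_t} {T : finLatticeType d}.
Implicit Types (a : T) (C : {set T}).

Definition principal_ideal a : {set T} := [set x | x <= a].

Definition is_chain C : bool := [forall x in C, forall y in C, x >=< y].

Definition chain_length C : nat := #|C|.-1.

Definition maximal_chain_of (A : {set T}) C : bool :=
  maxset (fun B => is_chain B && (B \subset A)) C.

End Ranked.

(* In a finite lattice every chain is finite, so only the equality of the
   lengths has to be required. *)
Definition ranked_lattice d (T : finLatticeType d) : Prop :=
  forall (a : T) (C D : {set T}),
    maximal_chain_of (principal_ideal a) C ->
    maximal_chain_of (principal_ideal a) D ->
    chain_length C = chain_length D.

(* Main.v *)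
Require Import Defs.
From mathcomp Require Import all_boot all_order.

(** Call a subset F of L prime when membership in F turns meets into
    conjunctions and joins into disjunctions; the empty set and the whole
    lattice are prime in this sense ([prime_filter]). The rank of an RC-closed
    set S is taken to be the number of distinct traces of prime sets F on S
    (its [traces]). For nonempty S this is the length of S, as a lattice, plus
    two.

    The set on which two prime sets agree is always RC-closed, because
    membership of a relative complement of x in [u, v] is a Boolean function of
    the memberships of u, x and v ([in_RCSub_agree]). So if S covers T in
    RCSub L and c is any element of S outside T, then two prime sets that agree
    on T and at c agree on the whole of S: a trace on S is a trace on T
    together with one bit, which tells whether c belongs to it.

    Choose c minimal in S outside T. A trace on T leaves this bit undetermined
    only if it is the set of the elements of T above c ([split_trace]), and
    for that trace both values of the bit occur ([exists_split]). The second
    claim is where both distributivity, which provides enough prime sets, and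
    the closure of T under relative complements are used. Hence
    exactly one trace on T splits in two, and S has exactly one trace more
    than T ([card_traces_cover]). The empty set has one trace, and it is the
    least element of RCSub L; so a maximal chain of the ideal below X has as
    many elements as X has traces ([card_maximal_chain]). *)

Set Implicit Arguments.
Unset Strict Implicit.
Unset Printing Implicit Defensive.

Import Order.Theory Order.ClosedPredicates.
Local Open Scope order_scope.

(** * Maximal chains in a finite graded order *)

Section MaximalChains.
Context {d : Order.disp_t}.

Lemma ltn_card_lower_set (T : finPOrderType d) (x y : T) :
  x < y -> (#|[set z | (z <= x)%O]| < #|[set z | (z <= y)%O]|)%N.
Proof.
move=> xy; apply/proper_card/properP; split.
  by apply/subsetP => z; rewrite !inE => /le_trans; apply; apply: ltW.
by exists y; rewrite !inE ?lexx // lt_geF.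
Qed.

Lemma exists_minimal (T : finPOrderType d) (A : {set T}) :
  A != set0 -> exists2 m, m \in A & forall y, y < m -> y \notin A.
Proof.
case/set0Pn => x xA.
case: (arg_minnP (fun y => #|[set z | z <= y]|) xA) => m mA mmin.
exists m => // y /ltn_card_lower_set; rewrite ltnNge.
by apply: contra; apply: mmin.
Qed.

Lemma exists_maximal (T : finPOrderType d) (A : {set T}) :
  A != set0 -> exists2 m, m \in A & forall y, m < y -> y \notin A.
Proof.
case/set0Pn => x xA.
case: (arg_maxnP (fun y => #|[set z | z <= y]|) xA) => m mA mmax.
exists m => // y /ltn_card_lower_set; rewrite ltnNge.
by apply: contra; apply: mmax.
Qed.

Context {T : finLatticeType d}.
Implicit Types (a x y : T) (C : {set T}).

Lemma is_chainP C :
  reflect {in C &, forall x y, x >=< y} (is_chain C).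
Proof.
apply: (iffP forall_inP) => [H x y xC yC|H x xC].
  by have /forall_inP/(_ y yC) := H x xC.
by apply/forall_inP => y yC; apply: H.
Qed.

Lemma is_chainU1 x C :
  is_chain C -> {in C, forall y, x >=< y} -> is_chain (x |: C).
Proof.
move=> /is_chainP chC xC; apply/is_chainP => y z.
rewrite !in_setU1 => /predU1P[->|yC] /predU1P[->|zC].
- exact: comparablexx.
- exact: xC.
- by rewrite comparable_sym xC.
- exact: chC.
Qed.

(** The form in which maximality is used: adding such an x would give a chain
    of the ideal. *)
Lemma maximal_chain_mem a C x :
    maximal_chain_of (principal_ideal a) C -> x <= a ->
  {in C, forall y, x >=< y} -> x \in C.
Proof.
move=> /maxsetP[/andP[chC Ca] maxC] xa xC.
rewrite -(maxC (x |: C)) ?setU11 ?subsetUr // is_chainU1 //=.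
by rewrite subUset Ca andbT sub1set inE.
Qed.

(** By induction on the ideal below a. A maximal chain C contains a; if b is the
    greatest other element of C, then a covers b and C without a is a maximal
    chain of the ideal below b. *)
Lemma card_maximal_chain (rank : T -> nat) :
    (forall a, (forall x, ~~ (x < a)) -> rank a = 1%N) ->
    (forall a b, b < a -> (forall x, b < x -> ~~ (x < a)) ->
       rank a = (rank b).+1) ->
  forall a C, maximal_chain_of (principal_ideal a) C -> #|C| = rank a.
Proof.
move=> rank_min rank_cover a.
have [n] := ubnP #|[set z | z <= a]|; elim: n a => // n IHn a lea C maxC.
have /maxsetP[/andP[chC Ca] CmaxC] := maxC.
have {}Ca x : x \in C -> x <= a by move/(subsetP Ca); rewrite inE.
have aC : a \in C.
  apply: maximal_chain_mem maxC _ _ => // y /Ca ya.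
  by rewrite comparable_sym le_comparable.
rewrite (cardsD1 a) aC; have [D0|Dn0] := eqVneq (C :\ a) set0.
  rewrite D0 cards0 rank_min // => x; apply/negP => xa.
  have : x \in C :\ a; last by rewrite D0 inE.
  rewrite !inE lt_eqF //; apply: maximal_chain_mem maxC (ltW xa) _ => y yC.
  have : y \notin C :\ a by rewrite D0 inE.
  rewrite !inE yC andbT negbK => /eqP->.
  exact: le_comparable (ltW xa).
have [b bD bmax] := exists_maximal Dn0.
have /setD1P[ba bC] := bD.
have {ba} ltba : b < a by rewrite lt_neqAle ba Ca.
have Db y : y \in C :\ a -> y <= b.
  move=> yD; have /setD1P[_ yC] := yD.
  have /is_chainP/(_ y b yC bC) := chC.
  by case/comparable_leP => // /bmax; rewrite yD.
rewrite (rank_cover a b) // => [|x bx]; last first.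
  apply/negP => xa; have: x \notin C :\ a by apply: bmax.
  rewrite !inE lt_eqF //=; case/negP.
  apply: maximal_chain_mem maxC (ltW xa) _ => y yC.
  have [->|ya] := eqVneq y a; first exact: le_comparable (ltW xa).
  rewrite comparable_sym le_comparable // (le_trans _ (ltW bx)) //.
  by rewrite Db // !inE ya.
rewrite add1n (IHn b) //; first exact: leq_trans (ltn_card_lower_set ltba) _.
apply/maxsetP; split.
  apply/andP; split; last by apply/subsetP => y /Db; rewrite inE.
  apply/is_chainP => x y /setD1P[_ xC] /setD1P[_ yC].
  by have /is_chainP := chC; apply.
move=> B /andP[chB Bb] DB.
have {}Bb x : x \in B -> x <= b by move/(subsetP Bb); rewrite inE.
have aB : a \notin B by apply/negP => /Bb; rewrite lt_geF.
rewrite -(CmaxC (a |: B)) ?setU1K //.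
  apply/andP; split.
    apply: is_chainU1 => // y /Bb yb.
    by rewrite comparable_sym le_comparable // (le_trans yb) ?ltW.
  apply/subsetP => x; rewrite !inE => /predU1P[->//|/Bb xb].
  exact: le_trans xb (ltW ltba).
by rewrite -(setD1K aC) setUS.
Qed.

End MaximalChains.

(** * Prime filters and their traces *)

Section PrimeFilters.
Context {d : Order.disp_t} {L : finLatticeType d}.
Implicit Types (x y : L) (S F : {set L}).

(** The improper cases F = set0 and F = setT are admitted on purpose: they play
    the part of the points added below and above the spectrum of L, and make
    one counting argument cover sublattices that miss the bounds of L. *)
Definition prime_filter F : bool :=
  [forall x, forall y, ((x `&` y \in F) == (x \in F) && (y \in F)) &&
                       ((x `|` y \in F) == (x \in F) || (y \in F))].

Lemma prime_filterP F :
  reflect (forall x y, ((x `&` y \in F) = (x \in F) && (y \in F)) *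
                       ((x `|` y \in F) = (x \in F) || (y \in F)))
          (prime_filter F).
Proof.
apply: (iffP forallP) => [H x y|H x].
  by have /forallP/(_ y)/andP[/eqP-> /eqP->] := H x.
by apply/forallP => y; rewrite !H !eqxx.
Qed.

Lemma prime_filter0 : prime_filter set0.
Proof. by apply/prime_filterP => x y; rewrite !inE. Qed.

Lemma prime_filter_le F x y : prime_filter F -> x <= y -> x \in F -> y \in F.
Proof. by move=> /prime_filterP pF /join_r <-; rewrite pF => ->. Qed.

(** If y is a complement of x in [u, v], then y belongs to a prime set
    containing x exactly when u does, and to one not containing x exactly when
    v does. *)
Lemma in_RCSub_agree F G :
  prime_filter F -> prime_filter G ->
  in_RCSub [set x | (x \in F) == (x \in G)].
Proof.
move=> /prime_filterP pF /prime_filterP pG; apply/in_RCSubP; split.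
- by move=> x y; rewrite !inE !pF !pG => /eqP-> /eqP->.
- by move=> x y; rewrite !inE !pF !pG => /eqP-> /eqP->.
move=> u x v uE xE vE; apply/subsetP => y.
rewrite [y \in rc _ _ _]inE => /andP[/eqP xyu /eqP xyv]; move: uE xE vE.
rewrite -xyu -xyv !inE !pF !pG => + /eqP xFG; rewrite xFG.
by case: (x \in G).
Qed.

Definition traces S : {set {set L}} :=
  [set S :&: F | F in [set F | prime_filter F]].

Lemma traces0 : traces set0 = [set set0].
Proof.
apply/setP => G; rewrite inE; apply/imsetP/eqP => [[F _ ->]|->].
  exact: set0I.
by exists set0; rewrite ?inE ?prime_filter0 // set0I.
Qed.

Lemma in_traces F S : prime_filter F -> S :&: F \in traces S.
Proof. by move=> pF; apply/imsetP; exists F; rewrite ?inE. Qed.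

Lemma exists_least (A : {set L}) :
  meet_closed A -> A != set0 -> exists2 m, m \in A & {in A, forall y, m <= y}.
Proof.
move=> AI /exists_minimal[m mA mmin]; exists m => // y yA.
have := leIl m y; rewrite le_eqVlt => /predU1P[/meet_idPl//|/mmin].
by rewrite AI.
Qed.

End PrimeFilters.

(** * The number of traces along a covering pair *)

Section Cover.
Context {d : Order.disp_t} {L : finDistrLatticeType d}.
Implicit Types (c x y : L) (A B S T F G : {set L}).

(** The prime ideal theorem, for sets that may be empty; the empty set is the
    required F when A is empty. Otherwise let m be the least element of A. An
    element j that is minimal among those below m and below no element of B is
    join prime: if j <= x `|` y, then j `&` x and j `&` y cannot both be
    strictly below j, as j would then lie below a join of two elements of B.
    The filter above j separates A from B. *)
Lemma prime_filter_separation A B :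
    meet_closed A -> join_closed B ->
    {in A & B, forall x y, ~~ (x <= y)} ->
  exists F, [/\ prime_filter F, A \subset F & [disjoint B & F]].
Proof.
move=> AI BU AB; have [->|A0] := eqVneq A set0.
  exists set0.
  by rewrite prime_filter0 sub0set disjoint_sym disjoints_subset sub0set.
have [m mA mmin] := exists_least AI A0.
pose J := [set j | (j <= m) && [forall b in B, ~~ (j <= b)]].
have /exists_minimal[j] : J != set0.
  by apply/set0Pn; exists m; rewrite inE lexx; apply/forall_inP => b; apply: AB.
rewrite inE => /andP[jm /forall_inP jB] jmin.
have below x : ~~ (j <= x) -> exists2 b, b \in B & j `&` x <= b.
  move=> jx; have /jmin : j `&` x < j by rewrite lt_neqAle leIl andbT eq_meetl.
  rewrite inE (le_trans (leIl _ _) jm) /= negb_forall_in.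
  by case/exists_inP => b bB; rewrite negbK; exists b.
exists [set x | j <= x]; split.
- apply/prime_filterP => x y; rewrite !inE lexI; split=> //.
  apply/idP/orP => [jxy|[] jx]; last 2 first.
  + by rewrite lexU2 ?jx.
  + by rewrite lexU2 ?jx ?orbT.
  apply/orP; apply: contraT; rewrite negb_or.
  case/andP => /below[b bB jb] /below[b' b'B jb'].
  have /negP[] := jB _ (BU _ _ bB b'B).
  by rewrite -(meet_l jxy) meetUr leU2.
- by apply/subsetP => x /mmin mx; rewrite inE (le_trans jm).
by rewrite disjoints_subset; apply/subsetP => x /jB; rewrite !inE.
Qed.

Section MinimalNewElement.
Variables (S T : {set L}) (c : L).
Hypotheses (RS : in_RCSub S) (RT : in_RCSub T) (TS : T \subset S).
Hypotheses (cS : c \in S) (cT : c \notin T).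
Hypothesis minc : forall y, y \in S -> y < c -> y \in T.

Lemma below_new y : y \in S -> ~~ (c <= y) -> c `&` y \in T.
Proof.
move=> yS cy; have /in_RCSubP[SI _ _] := RS; apply: minc; first exact: SI.
by rewrite lt_neqAle leIl andbT eq_meetl.
Qed.

(** Otherwise c would be the join of two elements of S strictly below it; both
    would lie in T by minimality of c, and so would c. *)
Lemma new_join_prime x y : x \in S -> y \in S ->
  c <= x `|` y -> (c <= x) || (c <= y).
Proof.
move=> xS yS cxy; apply: contraNT cT; rewrite negb_or => /andP[cx cy].
have /in_RCSubP[_ TU _] := RT.
by rewrite -(meet_l cxy) meetUr TU ?below_new.
Qed.

(** If y is in T and in F but not above c, then c `&` y is in F and, by
    minimality of c, in T; so it is in G, and G contains c. *)
Lemma split_trace F G :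
    prime_filter F -> prime_filter G -> T :&: F = T :&: G ->
  c \in F -> c \notin G -> T :&: F = [set y in T | c <= y].
Proof.
move=> pF pG FG cF cG; apply/setP => y; rewrite !inE.
have [yT /=|//] := boolP (y \in T).
apply/idP/idP => [yF|cy]; last exact: prime_filter_le cF.
apply: contraNT cG => cy.
have yS : y \in S by apply: subsetP yT.
have cyT := below_new yS cy.
have : c `&` y \in T :&: F.
  by rewrite inE cyT; have /prime_filterP-> := pF; rewrite cF.
by rewrite FG inE => /andP[_]; apply: prime_filter_le => //; apply: leIl.
Qed.

(** Let Y and A be the elements of T not above c and above c. Since c is join
    prime in S, Y is closed under joins, so there are prime sets with trace A
    on T. F is obtained by separating c from Y, and G by separating A from c
    and the elements c `|` y with y in Y. The latter separation is possible
    because a <= c `|` y, with a in A, would make c a complement of y `&` a in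
    [c `&` y, a], while these three elements lie in T. *)
Lemma exists_split : exists F G,
  [/\ prime_filter F, prime_filter G, T :&: F = T :&: G, c \in F & c \notin G].
Proof.
have /in_RCSubP[TI TU TR] := RT.
pose Y := [set y in T | ~~ (c <= y)]; pose A := [set y in T | c <= y].
have TtoS y : y \in T -> y \in S by apply: subsetP.
have YU : join_closed Y.
  move=> x y; rewrite !inE => /andP[xT cx] /andP[yT cy]; rewrite TU //=.
  apply: contra (new_join_prime (TtoS _ xT) (TtoS _ yT)) _.
  by rewrite negb_or cx.
have AI : meet_closed A.
  by move=> x y; rewrite !inE lexI => /andP[xT ->] /andP[yT ->]; rewrite TI.
have trace F : prime_filter F -> A \subset F -> [disjoint Y & F] -> T :&: F = A.
  move=> pF /subsetP AF YF; apply/setP => y; rewrite !inE.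
  have [yT|//] := boolP (y \in T); have [cy|cy] := boolP (c <= y).
    by rewrite AF // inE yT.
  by rewrite (disjointFr YF) // inE yT.
have [||x y|F [pF cF YF]] := @prime_filter_separation [set c] Y.
- by move=> x y; rewrite !inE => /eqP-> /eqP->; rewrite meetxx.
- exact: YU.
- by rewrite !inE => /eqP-> /andP[].
have {}cF : c \in F by rewrite -sub1set.
have AF : A \subset F.
  by apply/subsetP => y; rewrite inE => /andP[_ cy]; apply: prime_filter_le cF.
have [|||G [pG AG BG]] :=
    @prime_filter_separation A (c |: [set c `|` y | y in Y]).
- exact: AI.
- move=> x y /setU1P[->|/imsetP[x' x'Y ->]] /setU1P[->|/imsetP[y' y'Y ->]].
  + by rewrite joinxx setU11.
  + by rewrite joinA joinxx setU1r ?imset_f.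
  + by rewrite joinAC joinxx setU1r ?imset_f.
  + by rewrite joinACA joinxx setU1r ?imset_f ?YU.
- move=> a b; rewrite inE => /andP[aT ca] /setU1P[->|/imsetP[y]].
    apply: contra cT => ac.
    by rewrite (_ : c = a) //; apply/eqP; rewrite eq_le ca.
  rewrite inE => /andP[yT cy] ->; apply: contra cT => acy.
  have /subsetP := TR _ _ _ (below_new (TtoS _ yT) cy) (TI _ _ yT aT) aT.
  (* c is in rc (c `&` y) (y `&` a) a *)
  apply; rewrite inE; apply/andP; split; apply/eqP.
    by rewrite meetAC [y `&` c]meetC (meet_l (le_trans (leIl _ _) ca)).
  rewrite joinIl (join_l ca) joinC; exact: meet_r.
have cG : c \notin G by rewrite (disjointFr BG) ?setU11.
have YG : [disjoint Y & G].
  rewrite disjoints_subset; apply/subsetP => y yY; rewrite inE.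
  have : c `|` y \notin G by rewrite (disjointFr BG) // setU1r ?imset_f.
  by apply: contra; apply: prime_filter_le => //; apply: leUr.
by exists F, G; rewrite !trace.
Qed.

End MinimalNewElement.

(** Restriction to T maps the traces on S onto the traces on T, and only the
    trace common to F and G has two preimages. So restriction becomes a
    bijection when S :&: F is removed. *)
Lemma card_traces_cover S T :
    in_RCSub S -> in_RCSub T -> T \proper S ->
    (forall R, in_RCSub R -> T \proper R -> ~~ (R \proper S)) ->
  #|traces S| = #|traces T|.+1.
Proof.
move=> RS RT TS cov; have sTS := proper_sub TS.
have /exists_minimal[c /setDP[cS cT] minD] : S :\: T != set0.
  by rewrite setD_eq0; case/andP: TS.
have minc y : y \in S -> y < c -> y \in T.
  by move=> yS /minD; rewrite inE yS andbT negbK.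
(* The agreement set of F and G within S is RC-closed and contains T and c, so
   it is S because nothing lies strictly between T and S. *)
have det F G : prime_filter F -> prime_filter G -> T :&: F = T :&: G ->
    (c \in F) = (c \in G) -> S :&: F = S :&: G.
  move=> pF pG FG cFG; pose E := [set x | (x \in F) == (x \in G)].
  have RE : in_RCSub (S :&: E) by rewrite in_RCSubI ?in_RCSub_agree.
  have TE : T \proper S :&: E.
    apply/properP; split; last by exists c; rewrite // !inE cS cFG eqxx.
    rewrite subsetI sTS; apply/subsetP => x xT.
    by move/setP/(_ x): FG; rewrite !inE xT /= => ->.
  have := cov _ RE TE; rewrite properE subsetIl negbK => /subsetP SE.
  apply/setP => x; rewrite !inE; have [xS|//] := boolP (x \in S).
  by have := SE x xS; rewrite !inE => /andP[_ /eqP].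
have [F [G [pF pG FG cF cG]]] := exists_split RS RT sTS cS cT minc.
have restr H : T :&: (S :&: H) = T :&: H by rewrite setIA (setIidPl sTS).
(* Every trace that contains c and shares its restriction to T with a trace
   missing c is the removed one. *)
have traceF H K : prime_filter H -> prime_filter K -> T :&: H = T :&: K ->
    c \in H -> c \notin K -> S :&: H = S :&: F.
  move=> pH pK HK cH cK; apply: det => //; last by rewrite cH cF.
  by rewrite (split_trace RS sTS cS minc pH pK HK) //
             (split_trace RS sTS cS minc pF pG FG).
rewrite (cardsD1 (S :&: F)) in_traces // add1n; congr _.+1.
rewrite -(card_in_imset (f := setI T)); last first.
  move=> A B /setD1P[+ /imsetP[H + HE]] /setD1P[+ /imsetP[K + KE]].
  rewrite {A}HE {B}KE !inE !restr => nH pH nK pK HK.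
  apply: det => //; apply/idP/idP => [cH|cK]; apply: contraT => nc.
    by rewrite (traceF H K) ?eqxx in nH.
  by rewrite (traceF K H) ?eqxx in nK.
congr #|pred_of_set _|; apply/setP => H'; apply/imsetP/imsetP.
  move=> [_ /setD1P[_ /imsetP[H pH ->]] ->].
  by exists H; rewrite ?restr.
move=> [H]; rewrite inE => pH ->.
have [HF|HF] := eqVneq (S :&: H) (S :&: F); last first.
  by exists (S :&: H); rewrite ?restr // in_setD1 HF in_traces.
exists (S :&: G); last by rewrite restr -FG -(restr H) HF restr.
rewrite in_setD1 in_traces // andbT; apply: contra cG => /eqP/setP/(_ c).
by rewrite !inE cS cF.
Qed.

End Cover.

Theorem theorem3 (d : Order.disp_t) (L : finDistrLatticeType d) :
  ranked_lattice (RCSub L).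
Proof.
suff card_chain (X : RCSub L) C :
    maximal_chain_of (principal_ideal X) C -> #|C| = #|traces X|.
  by move=> X C D maxC maxD; rewrite /chain_length !(card_chain X).
apply: (card_maximal_chain (rank := fun X : RCSub L => #|traces X|)) => {X C}.
  move=> X minX; have R0 : in_RCSub (set0 : {set L}) by rewrite /in_RCSub eqxx.
  have := minX (MkRCSub R0); rewrite lt_leAnge !leERCSub sub0set /= negbK.
  by rewrite subset0 => /eqP->; rewrite traces0 cards1.
have ltE (X Y : RCSub L) : (X < Y) = (RCSub_set X \proper RCSub_set Y).
  by rewrite lt_leAnge !leERCSub properE.
move=> X Y; rewrite ltE => YX cov.
apply: card_traces_cover (RCSub_axiom X) (RCSub_axiom Y) YX _ => R RR YR.
by have := cov (MkRCSub RR); rewrite !ltE; apply.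
Qed.
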